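(* Let $n\ge 1$. An element $X \in \mathfrak{sp}(2n,\mathbb{C})$ is strongly $\mathrm{Ad}_{\mathrm{Sp}(2n,\mathbb{C})}$-real if and only if the Jordan blocks in the Jordan decomposition of $X$ satisfy both of the following conditions: (1) for every $m\ge 1$, the nilpotent Jordan block $\mathrm{J}(0,2m)$ of even size has even multiplicity; (2) for every non-zero eigenvalue $\lambda$ of $X$ and every $k\ge 1$, the Jordan block $\mathrm{J}(\lambda,k)$ has even multiplicity.
   Context: Let $\mathrm{I}_n$ be the $n\times n$ identity matrix and $\mathrm{J}_{2n} = \begin{pmatrix} 0 & \mathrm{I}_n\\ -\mathrm{I}_n & 0\end{pmatrix}$. Set $\mathrm{Sp}(2n,\mathbb{C}) = \{ g \in \mathrm{GL}(2n,\mathbb{C}) \mid g^T \mathrm{J}_{2n} g = \mathrm{J}_{2n}\}$ and $\mathfrak{sp}(2n,\mathbb{C}) = \{X \in \mathrm{M}(2n,\mathbb{C}) \mid X^T \mathrm{J}_{2n} = -\mathrm{J}_{2n}X\}$. An element $X\in\mathfrak{sp}(2n,\mathbb{C})$ is called strongly $\mathrm{Ad}_{\mathrm{Sp}(2n,\mathbb{C})}$-real if there is $h\in \mathrm{Sp}(2n,\mathbb{C})$ with $h^2=\mathrm{I}_{2n}$ and $hXh^{-1}=-X$. $\mathrm{J}(\lambda,m)$ denotes the $m\times m$ Jordan block with $\lambda$ on the diagonal, $1$ on the super-diagonal, and $0$ elsewhere. The multiplicity of $\mathrm{J}(\lambda,k)$ is the number of times it occurs in the Jordan form of $X$ in $\mathrm{M}(2n,\mathbb{C})$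 (possibly zero, which counts as even). *)

(* Defs.v *)
From mathcomp Require Import all_boot all_order all_algebra.
From mathcomp Require Import complex classical_sets reals.

Set Implicit Arguments.
Unset Strict Implicit.
Unset Printing Implicit Defensive.

Import GRing.Theory Num.Theory.
Local Open Scope ring_scope.

Section Symplectic.
Variables (F : fieldType) (n : nat).

Definition symplectic_form : 'M[F]_(n + n) := block_mx 0 1%:M (- 1%:M) 0.

Definition in_Sp (g : 'M[F]_(n + n)) : Prop :=
  g \in unitmx /\ g^T *m symplectic_form *m g = symplectic_form.

Definition in_sp (X : 'M[F]_(n + n)) : Prop :=
  X^T *m symplectic_form = - (symplectic_form *m X).

Definition strongly_Ad_real (X : 'M[F]_(n + n)) : Prop :=
  exists h : 'M[F]_(n + n),
    [/\ in_Sp h, h *m h = 1%:M & h *m X *m invmx h = - X].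

End Symplectic.

Section Jordan.
Variable F : fieldType.

Definition jordan_block (lambda : F) (m : nat) : 'M[F]_m :=
  \matrix_(i < m, j < m)
    if i == j then lambda else if i.+1 == j :> nat then 1 else 0.

(* A pair (lambda, k) in s stands for the block J(lambda, k). *)
Definition jordan_mx (s : seq (F * nat)) :
    'M[F]_(\sum_(i < size s) (tnth (in_tuple s) i).2) :=
  \mxdiag_(i < size s)
    jordan_block (tnth (in_tuple s) i).1 (tnth (in_tuple s) i).2.

(* Blocks of size 0 are excluded, which makes s unique up to permutation. *)
Definition is_jordan_form (m : nat) (X : 'M[F]_m) (s : seq (F * nat)) : Prop :=
  all (fun b => 0 < b.2)%N s /\
  exists (e : (\sum_(i < size s) (tnth (in_tuple s) i).2)%N = m) (P : 'M[F]_m),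
    P \in unitmx /\ X = P *m castmx (e, e) (jordan_mx s) *m invmx P.

(* Some Jordan form of X. The default [::] is only taken if X has none, which
   cannot happen over an algebraically closed field. *)
Definition jordan_form (m : nat) (X : 'M[F]_m) : seq (F * nat) :=
  xget [::] [set s | is_jordan_form X s]%classic.

Definition jordan_multiplicity (m : nat) (X : 'M[F]_m) (lambda : F) (k : nat) :
    nat := count_mem (lambda, k) (jordan_form X).

End Jordan.

(* Main.v *)
Require Import Defs.
From mathcomp Require Import all_boot all_order all_algebra.
From mathcomp Require Import complex reals zify ring.

(** Write J for the symplectic form.  If h is a symplectic involution with
    h X = - X h, then J (X - a)^k h is alternating for all a and k, so that
    every (X - a)^k has even rank; the multiplicity of J(a, k) is a second
    difference of these ranks.  For even powers of X the form J X^(2k) is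
    alternating in any case, which settles the nilpotent blocks of odd size.
    Conversely, X and - X^T are similar, so even multiplicities let one group
    the Jordan blocks into sums Y + Y on which another symplectic form W, and
    an involution s preserving W and reversing X, can be written down.  Then
    W = J A with A commuting with X, and A has a square root B that is a
    polynomial in A; since W = B^T J B, the involution B s B^-1 is
    J-symplectic and still reverses X. *)

Set Implicit Arguments.
Unset Strict Implicit.
Unset Printing Implicit Defensive.
Import GRing.Theory Num.Theory.
Local Open Scope ring_scope.

(** * Similarity of square matrices and block sums *)

(** The two sizes are separate parameters, so that matrices whose sizes are only provably equal can
    be compared without casts. *)
Definition similar (F : fieldType) (m n : nat) (A : 'M[F]_m) (B : 'M[F]_n) :
    Prop :=
  exists (P : 'M[F]_(m, n)) (Q : 'M[F]_(n, m)),
    [/\ P *m Q = 1%:M, Q *m P = 1%:M & A *m P = P *m B].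

Section Similarity.
Variable F : fieldType.
Implicit Types m n p q k : nat.

Definition dsum m n (A : 'M[F]_m) (B : 'M[F]_n) : 'M[F]_(m + n) :=
  block_mx A 0 0 B.

Lemma expmx0 m (A : 'M[F]_m) : A ^+ 0 = 1%:M.
Proof. by []. Qed.

Lemma expmxS m (A : 'M[F]_m) k : A ^+ k.+1 = A *m A ^+ k.
Proof. exact: exprS. Qed.

Lemma expmxSr m (A : 'M[F]_m) k : A ^+ k.+1 = A ^+ k *m A.
Proof. exact: exprSr. Qed.

Lemma similar_refl m (A : 'M[F]_m) : similar A A.
Proof. by exists 1%:M, 1%:M; rewrite !mulmx1 !mul1mx. Qed.

Lemma similar_sym m n (A : 'M[F]_m) (B : 'M[F]_n) : similar A B -> similar B A.
Proof.
move=> [P [Q [PQ QP AP]]]; exists Q, P; split=> //.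
by rewrite -[B *m Q]mul1mx -QP -!mulmxA [P *m (B *m Q)]mulmxA -AP -mulmxA PQ mulmx1.
Qed.

Lemma similar_trans m n p (B : 'M[F]_n) (A : 'M[F]_m) (C : 'M[F]_p) :
  similar A B -> similar B C -> similar A C.
Proof.
move=> [P [Q [PQ QP AP]]] [P' [Q' [PQ' QP' AP']]].
exists (P *m P'), (Q' *m Q); split.
- by rewrite mulmxA -[P *m P' *m Q']mulmxA PQ' mulmx1.
- by rewrite mulmxA -[Q' *m Q *m P]mulmxA QP mulmx1.
- by rewrite mulmxA AP -!mulmxA AP'.
Qed.

Lemma similar_cast m n (e : m = n) (A : 'M[F]_m) : similar (castmx (e, e) A) A.
Proof. by case: _ / e; rewrite castmx_id; apply: similar_refl. Qed.

Lemma similar_size m n (A : 'M[F]_m) (B : 'M[F]_n) : similar A B -> m = n.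
Proof.
move=> [P [Q [PQ QP _]]]; apply/eqP; rewrite eqn_leq.
by rewrite (mulmx1_min PQ) (mulmx1_min QP).
Qed.

Lemma similar_dsum m n p q (A : 'M[F]_m) (A' : 'M[F]_n) (B : 'M[F]_p)
    (B' : 'M[F]_q) :
  similar A A' -> similar B B' -> similar (dsum A B) (dsum A' B').
Proof.
move=> [P [Q [PQ QP AP]]] [P' [Q' [PQ' QP' AP']]].
exists (block_mx P 0 0 P'), (block_mx Q 0 0 Q').
by split; rewrite !mulmx_block !mulmx0 !mul0mx !addr0 !add0r
  ?PQ ?PQ' ?QP ?QP' ?AP ?AP' // -scalar_mx_block.
Qed.

Lemma similar_dsumA m n p (A : 'M[F]_m) (B : 'M[F]_n) (C : 'M[F]_p) :
  similar (dsum A (dsum B C)) (dsum (dsum A B) C).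
Proof.
have -> : dsum A (dsum B C) = castmx (esym (addnA m n p), esym (addnA m n p))
    (dsum (dsum A B) C).
  by rewrite /dsum -(row_mx0 F m n p) -(col_mx0 F n p m) block_mxA row_mx0 col_mx0.
exact: similar_cast.
Qed.

Lemma similar_dsumC m n (A : 'M[F]_m) (B : 'M[F]_n) :
  similar (dsum A B) (dsum B A).
Proof.
exists (block_mx 0 1%:M 1%:M 0), (block_mx 0 1%:M 1%:M 0).
by split; rewrite !mulmx_block !mulmx0 !mul0mx !mulmx1 ?mul1mx !addr0 !add0r //
  -scalar_mx_block.
Qed.

Lemma similar_dsum0 n (A : 'M[F]_0) (B : 'M[F]_n) : similar B (dsum A B).
Proof.
exists (row_mx 0 1%:M), (col_mx 0 1%:M); split.
- by rewrite mul_row_col mul0mx add0r mulmx1.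
- rewrite mul_col_row !mul0mx mulmx0 mul1mx [RHS]scalar_mx_block; congr block_mx.
  by apply/matrixP=> - [].
- by rewrite /dsum mul_row_block mul_mx_row !mulmx0 !mul0mx !addr0 !add0r mulmx1 mul1mx.
Qed.

Lemma similar_mxrank m n (A : 'M[F]_m) (B : 'M[F]_n) :
  similar A B -> \rank A = \rank B.
Proof.
have le_rank m1 n1 (A1 : 'M[F]_m1) (B1 : 'M[F]_n1) :
    similar A1 B1 -> (\rank A1 <= \rank B1)%N.
  move=> [P [Q [PQ _ AP]]]; rewrite -[A1]mulmx1 -PQ mulmxA AP.
  exact: leq_trans (mxrankM_maxl _ _) (mxrankM_maxr _ _).
by move=> s; apply/eqP; rewrite eqn_leq !le_rank //; apply: similar_sym.
Qed.

Lemma similar_subX m n (A : 'M[F]_m) (B : 'M[F]_n) a k :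
  similar A B -> similar ((A - a%:M) ^+ k) ((B - a%:M) ^+ k).
Proof.
move=> [P [Q [PQ QP AP]]]; exists P, Q; split=> //.
have AP1: (A - a%:M) *m P = P *m (B - a%:M).
  by rewrite mulmxBl mulmxBr AP scalar_mxC.
elim: k => [|k IHk]; first by rewrite !expmx0 mul1mx mulmx1.
by rewrite !expmxS -mulmxA IHk !mulmxA AP1.
Qed.

Lemma dsum_subX m n (A : 'M[F]_m) (B : 'M[F]_n) a k :
  (dsum A B - a%:M) ^+ k = dsum ((A - a%:M) ^+ k) ((B - a%:M) ^+ k).
Proof.
elim: k => [|k IHk]; first by rewrite !expmx0 /dsum -scalar_mx_block.
rewrite !expmxS IHk /dsum scalar_mx_block opp_block_mx add_block_mx.
by rewrite !oppr0 !addr0 mulmx_block !mulmx0 !mul0mx !addr0 !add0r.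
Qed.

End Similarity.

(** * Jordan matrices as iterated block sums *)

Section JordanSum.
Variable F : fieldType.
Implicit Types (s : seq (F * nat)) (b : F * nat).

Notation jblock b := (jordan_block b.1 b.2).

Fixpoint jordan_dim s := if s is b :: s' then (b.2 + jordan_dim s')%N else 0%N.

(** The size unfolds together with the list, so that inductions on [s] need no casts. *)
Fixpoint jordan_sum s : 'M[F]_(jordan_dim s) :=
  if s is b :: s' then dsum (jblock b) (jordan_sum s') else 0.

(** With an arbitrary [f] in place of [tnth], the induction can pass to the shifted family. *)
Lemma mxdiag_jordan_block k (f : 'I_k -> F * nat) :
  similar (\mxdiag_(i < k) jblock (f i)) (jordan_sum (codom f)).
Proof.
elim: k f => [|k IHk] f.
  rewrite codomE (size0nil (size_enum_ord 0)).
  exists 0, 0; split; apply/matrixP => i j; [| by case: i | by case: j].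
  by have := ltn_ord i; rewrite {2}big_ord0.
rewrite codomE enum_ordSl /= -map_comp -codomE mxdiag_recl.
apply: similar_trans (similar_cast _ _) _.
exact: similar_dsum (similar_refl _) (IHk _).
Qed.

Lemma jordan_mx_similar s : similar (jordan_mx s) (jordan_sum s).
Proof.
have := mxdiag_jordan_block (tnth (in_tuple s)).
by rewrite codomE (map_tnth_enum (in_tuple s)).
Qed.

Lemma jordan_sum_cat s1 s2 :
  similar (jordan_sum (s1 ++ s2)) (dsum (jordan_sum s1) (jordan_sum s2)).
Proof.
elim: s1 => [|b s1 IHs] /=; first exact: similar_dsum0.
apply: similar_trans (similar_dsumA _ _ _).
exact: similar_dsum (similar_refl _) IHs.
Qed.

Lemma jordan_sum_perm s1 s2 :
  perm_eq s1 s2 -> similar (jordan_sum s1) (jordan_sum s2).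
Proof.
elim: s1 s2 => [|b s1 IHs] s2.
  by move/perm_size/esym/size0nil->; apply: similar_refl.
move=> p12; have bs2: b \in s2 by rewrite -(perm_mem p12) mem_head.
case/path.splitPr: bs2 p12 => u v p12.
have p12' : perm_eq s1 (u ++ v).
  by rewrite -(perm_cons b) (perm_trans p12) // perm_catC /= perm_cons perm_catC.
apply: (similar_trans (similar_dsum (similar_refl _) (IHs _ p12'))).
apply: (similar_trans (similar_dsum (similar_refl _) (jordan_sum_cat _ _))).
apply: (similar_trans (similar_dsumA _ _ _)).
apply: (similar_trans (similar_dsum (similar_dsumC _ _) (similar_refl _))).
apply: (similar_trans (similar_sym (similar_dsumA _ _ _))).
exact: similar_sym (jordan_sum_cat u (b :: v)).
Qed.

Lemma is_jordan_formP m (X : 'M[F]_m) s :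
  is_jordan_form X s <->
  all (fun b => 0 < b.2)%N s /\ similar X (jordan_sum s).
Proof.
split=> -[s_gt0].
  move=> [e [P [uP ->]]]; split=> //.
  apply: similar_trans (jordan_mx_similar s).
  apply: similar_trans (similar_cast e _).
  by exists P, (invmx P); rewrite mulmxV // mulVmx // mulmxKV.
move=> sX; split=> //.
have {}sX := similar_trans sX (similar_sym (jordan_mx_similar s)).
have e := esym (similar_size sX); exists e.
have [P [Q [PQ QP XP]]] := similar_trans sX (similar_sym (similar_cast e _)).
have [uP _] := mulmx1_unit PQ; exists P; split=> //.
by rewrite -XP mulmxK.
Qed.

End JordanSum.

(** * Block multiplicities as second differences of ranks *)

Section JordanRank.
Variable F : fieldType.
Implicit Types (s : seq (F * nat)) (b : F * nat) (a c : F).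

Lemma jordan_block_subM c a m :
  jordan_block c m - a%:M = jordan_block (c - a) m.
Proof.
by apply/matrixP => i j; rewrite !mxE; case: eqP => _; rewrite ?mulr1n // subr0.
Qed.

Lemma jordan_block_unit c m : c != 0 -> jordan_block c m \in unitmx.
Proof.
move=> c0; rewrite -unitmx_tr unitmxE det_trig.
  by rewrite unitfE prodf_seq_neq0; apply/allP => i _ /=; rewrite !mxE eqxx.
apply/is_trig_mxP => i j lt_ij; rewrite !mxE.
rewrite -val_eqE /= gtn_eqF //; case: ifP => // /eqP e.
by rewrite -e ltnNge leqnSn in lt_ij.
Qed.

Lemma expmx_unit m (A : 'M[F]_m) k : A \in unitmx -> A ^+ k \in unitmx.
Proof.
by move=> uA; elim: k => [|k IHk]; rewrite ?unitmx1 // expmxS unitmx_mul uA.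
Qed.

Lemma jordan_block0X m k :
  jordan_block 0 m ^+ k = \matrix_(i < m, j < m) ((i + k)%N == j)%:R :> 'M[F]_m.
Proof.
elim: k => [|k IHk].
  by rewrite expmx0; apply/matrixP => i j; rewrite !mxE addn0.
rewrite expmxS IHk; apply/matrixP => i j; rewrite !mxE.
have [lt_im|le_mi] := ltnP i.+1 m; last first.
  rewrite gtn_eqF ?big1 // => [l _|]; last by have := ltn_ord j; lia.
  rewrite !mxE; case: ifP => _; first by rewrite mul0r.
  by rewrite gtn_eqF ?mul0r //; have := ltn_ord l; lia.
rewrite (bigD1 (Ordinal lt_im)) //= big1 ?addr0 => [|l ne_l]; rewrite !mxE /=.
  rewrite eqxx addSnnS ifN ?mul1r //.
  by apply/eqP => /(congr1 val) /=; lia.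
case: ifP => _; rewrite ?mul0r // ifN ?mul0r //.
by apply: contra ne_l => /eqP e; apply/eqP/val_inj.
Qed.

(** With N the k-th power, [N *m N^T] is the projector [pid_mx (m - k)], and this projector fixes N
    from the left. Hence each of the two ranks bounds the other. *)
Lemma mxrank_jordan_block0X m k :
  \rank (jordan_block 0 m ^+ k : 'M[F]_m) = (m - k)%N.
Proof.
rewrite jordan_block0X; set N := \matrix_(i, j) _.
have NNt : N *m N^T = pid_mx (m - k).
  apply/matrixP => i j; rewrite !mxE.
  have [lt_im|le_mi] := ltnP i (m - k); last first.
    rewrite andbF big1 // => l _; rewrite !mxE gtn_eqF ?mul0r //.
    by have := ltn_ord l; lia.
  have lt_ikm : (i + k < m)%N by lia.
  rewrite andbT (bigD1 (Ordinal lt_ikm)) //= big1 ?addr0 => [|l ne_l].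
    by rewrite !mxE /= eqxx mul1r eqn_add2r eq_sym.
  rewrite !mxE; case: eqP => [e|_]; last by rewrite mul0r.
  by case/eqP: ne_l; apply: val_inj.
have pidN : pid_mx (m - k) *m N = N.
  apply/matrixP => i j; rewrite !mxE (bigD1 i) //= big1 ?addr0 => [|l ne_l].
    rewrite !mxE eqxx /=; have [_|le_mi] := ltnP i (m - k); first by rewrite mul1r.
    by rewrite mul0r gtn_eqF //; have := ltn_ord j; lia.
  by rewrite !mxE eq_sym val_eqE (negPf ne_l) mul0r.
rewrite -[RHS](@rank_pid_mx F m m) ?leq_subr //; apply/eqP; rewrite eqn_leq.
by rewrite -{1}pidN -NNt !mxrankM_maxl.
Qed.

(** For [b.1 != a] all powers are invertible and the three ranks agree. Otherwise the ranks are
    truncated differences [b.2 - j], whose graph has its only kink at [j = b.2]. The additive form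
    avoids a further truncated subtraction. *)
Lemma mxrank_jordan_block a b k : (0 < b.2)%N ->
  let r j := \rank ((jordan_block b.1 b.2 - a%:M) ^+ j) in
  (r k + r k.+2 = 2 * r k.+1 + (b == (a, k.+1)))%N.
Proof.
case: b => c m /= m_gt0; rewrite xpair_eqE jordan_block_subM.
have [<-|ca] := eqVneq c a; last first.
  by rewrite !mxrank_unit ?expmx_unit ?jordan_block_unit ?subr_eq0 //; lia.
by rewrite subrr !mxrank_jordan_block0X; lia.
Qed.

Lemma mxrank_jordan_sum a s k : all (fun b => 0 < b.2)%N s ->
  let r j := \rank ((jordan_sum s - a%:M) ^+ j) in
  (r k + r k.+2 = 2 * r k.+1 + count_mem (a, k.+1) s)%N.
Proof.
elim: s => [|b s IHs] /=.
  by have rank0 (A : 'M[F]_0) : \rank A = 0%N; rewrite ?flatmx0 ?mxrank0 // !rank0.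
move=> /andP[b_gt0 /IHs]; have := mxrank_jordan_block a k b_gt0.
rewrite /= !dsum_subX /dsum !rank_diag_block_mx => e1 e2.
by rewrite addnACA e1 e2 mulnDr addnACA.
Qed.

Lemma is_jordan_form_count m (X : 'M[F]_m) s a k : is_jordan_form X s ->
  let r j := \rank ((X - a%:M) ^+ j) in
  (r k + r k.+2 = 2 * r k.+1 + count_mem (a, k.+1) s)%N.
Proof.
move=> /is_jordan_formP[s_gt0 Xs] /=.
by rewrite !(similar_mxrank (similar_subX a _ Xs)) mxrank_jordan_sum.
Qed.

End JordanRank.

(** * Splitting off one Jordan block *)

Section JordanExistence.
Variable F : fieldType.

Definition krylov m (u : 'rV[F]_m) (N : 'M[F]_m) k : 'M[F]_(k, m) :=
  \matrix_(i < k) (u *m N ^+ i).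

Lemma krylov_shift m (u : 'rV[F]_m) (N : 'M[F]_m) k : u *m N ^+ k = 0 ->
  krylov u N k *m N = jordan_block 0 k *m krylov u N k.
Proof.
move=> uNk; apply/row_matrixP => i; rewrite !row_mul rowK -mulmxA -expmxSr.
rewrite [RHS]mulmx_sum_row.
have [lt_ik|le_ki] := ltnP i.+1 k; last first.
  have -> : i.+1 = k by have := ltn_ord i; lia.
  rewrite uNk big1 // => l _; rewrite !mxE.
  case: ifP => _; first by rewrite scale0r.
  by rewrite gtn_eqF ?scale0r //; have := ltn_ord l; lia.
rewrite (bigD1 (Ordinal lt_ik)) //= big1 ?addr0 => [|l ne_l].
  rewrite !mxE ifN ?eqxx ?scale1r ?rowK //.
  by apply/eqP => /(congr1 val) /=; lia.
rewrite !mxE; case: ifP => _; first by rewrite scale0r.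
rewrite ifN ?scale0r //.
by apply: contra ne_l => /eqP e; apply/eqP/val_inj.
Qed.

Lemma trmxX m (A : 'M[F]_m) k : (A ^+ k)^T = A^T ^+ k.
Proof.
elim: k => [|k IHk]; first by rewrite !expmx0 trmx1.
by rewrite expmxS trmx_mul IHk -expmxSr.
Qed.

Lemma expmxD m (A : 'M[F]_m) j k : A ^+ (j + k) = A ^+ j *m A ^+ k.
Proof. exact: exprD. Qed.

(* The pairing matrix [krylov u N k *m (krylov w^T N^T k)^T] is a Hankel matrix
   vanishing below the antidiagonal. *)
Lemma krylov_unit m (u : 'rV[F]_m) (w : 'cV[F]_m) (N : 'M[F]_m) k :
  u *m N ^+ k.+1 = 0 -> u *m N ^+ k *m w != 0 ->
  krylov u N k.+1 *m (krylov w^T N^T k.+1)^T \in unitmx.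
Proof.
move=> uN uNw; set G := _ *m _.
have GE i j : G i j = (u *m N ^+ (i + j) *m w) 0 0.
  rewrite expmxD mulmxA -mulmxA -[_ *m w]trmxK trmx_mul trmxX.
  rewrite /G mxE [RHS]mxE; apply: eq_bigr => l _.
  by rewrite !mxE; congr (_ * _); rewrite !mxE.
(* Reversing the rows makes G lower triangular, with [u *m N ^+ k *m w] all along the diagonal. *)
suff: rowsub (@rev_ord k.+1) G \in unitmx by rewrite rowsubE unitmx_mul => /andP[].
rewrite unitmxE det_trig.
  rewrite unitfE prodf_seq_neq0; apply/allP => i _ /=.
  rewrite mxE GE /= subSS subnK; last by rewrite -ltnS.
  by apply: contra uNw => /eqP e; apply/eqP/matrixP => x y; rewrite !ord1 e mxE.
apply/is_trig_mxP => i j lt_ij; rewrite mxE GE /= subSS.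
have -> : (k - i + j = k.+1 + (j - i).-1)%N.
  by have := ltn_ord j; have := ltn_ord i; lia.
by rewrite expmxD mulmxA uN !mul0mx mxE.
Qed.

(** The row space of U and the left kernel of W are both stable under X, and invertibility of
    [U *m W] makes them complementary. *)
Lemma similar_splitting m k (X : 'M[F]_m) (J : 'M[F]_k) (J' : 'M[F]_k)
    (U : 'M[F]_(k, m)) (W : 'M[F]_(m, k)) :
  U *m X = J *m U -> X *m W = W *m J' -> U *m W \in unitmx ->
  exists r (Y : 'M[F]_r), similar X (dsum J Y).
Proof.
move=> UX XW uG; pose R := row_base (kermx W).
exists (\rank (kermx W)), (R *m X *m pinvmx R); apply: similar_sym.
set Y := R *m X *m _.
have RW : R *m W = 0.
  by apply/sub_kermxP; rewrite eq_row_base.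
have sub_R p (A : 'M_(p, m)) : A *m W = 0 -> A *m pinvmx R *m R = A.
  by move=> AW; rewrite mulmxKpV // eq_row_base; apply/sub_kermxP.
have RX : R *m X = Y *m R by rewrite sub_R // -mulmxA XW mulmxA RW mul0mx.
(* On row vectors, E is the projection onto the left kernel of W along the row space of U. *)
pose V := W *m invmx (U *m W); pose E := 1%:M - V *m U.
have UV : U *m V = 1%:M by rewrite mulmxA mulmxV.
have EW : E *m W = 0.
  by rewrite mulmxBl mul1mx -!mulmxA mulVmx // mulmx1 subrr.
exists (col_mx U R), (row_mx V (E *m pinvmx R)); split.
- have RV : R *m V = 0 by rewrite mulmxA RW mul0mx.
  have UE : U *m E = 0 by rewrite mulmxBr mulmx1 mulmxA UV mul1mx subrr.
  have RE : R *m E = R by rewrite mulmxBr mulmx1 mulmxA RV mul0mx subr0.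
  rewrite mul_col_row UV RV [U *m (_ *m _)]mulmxA [R *m (_ *m _)]mulmxA UE mul0mx RE.
  by rewrite mulmxVp ?row_base_free // -scalar_mx_block.
- by rewrite mul_row_col sub_R // addrC subrK.
- by rewrite /dsum mul_block_col mul_col_mx UX RX !mul0mx addr0 add0r.
Qed.

(** The rows u, uN, ..., uN^k form a Jordan chain. The columns w, Nw, ..., N^k w form a dual chain,
    and the vectors they annihilate give the invariant complement. *)
Lemma similar_jordan_splitting m k (X : 'M[F]_m) a (u : 'rV[F]_m)
    (w : 'cV[F]_m) (N := X - a%:M) :
  u *m N ^+ k.+1 = 0 -> N ^+ k.+1 *m w = 0 -> u *m N ^+ k *m w != 0 ->
  exists r (Y : 'M[F]_r), similar X (dsum (jordan_block a k.+1) Y).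
Proof.
move=> uN Nw uNw; have XE : X = N + a%:M by rewrite subrK.
have {}Nw : w^T *m N^T ^+ k.+1 = 0.
  by rewrite -trmxX -trmx_mul Nw trmx0.
have KN := krylov_shift uN; have /(congr1 trmx) KNt := krylov_shift Nw.
rewrite !trmx_mul trmxK in KNt.
have JE : jordan_block a k.+1 = jordan_block 0 k.+1 + a%:M :> 'M[F]_k.+1.
  by apply: (canRL (subrK _)); rewrite jordan_block_subM subrr.
apply: (similar_splitting (U := krylov u N k.+1)
  (W := (krylov w^T N^T k.+1)^T) (J' := (jordan_block 0 k.+1)^T + a%:M)).
- by rewrite [in LHS]XE JE mulmxDr mulmxDl KN scalar_mxC.
- by rewrite [in LHS]XE mulmxDr mulmxDl KNt scalar_mxC.
- exact: krylov_unit.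
Qed.

End JordanExistence.

(** * Jordan forms over an algebraically closed field *)

Section JordanExistenceClosed.
Variable F : closedFieldType.

(** Write the minimal polynomial as q(x) (x - a)^(k+1) with q(a) non-zero, and put Q = q(X). Then
    N^(k+1) kills Q on both sides, while Q N^k Q is non-zero; a non-zero entry of it selects a row u
    and a column w of Q. *)
Lemma exists_jordan_splitting m (X : 'M[F]_m.+1) :
  exists a k r (Y : 'M[F]_r), similar X (dsum (jordan_block a k.+1) Y).
Proof.
pose f := mxminpoly X; have f_neq0 : f != 0 by rewrite monic_neq0 ?mxminpoly_monic.
have /closed_rootP[a rfa] : size f != 1%N.
  by rewrite size_mxminpoly eqSS -lt0n mxminpoly_nonconstant.
have [[|k] [q]] := multiplicity_XsubC f a; rewrite f_neq0 /= => qa fE.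
  by rewrite fE expr0 mulr1 (negPf qa) in rfa.
pose N := X - a%:M; have NE : horner_mx X ('X - a%:P) = N.
  by rewrite rmorphB /= horner_mx_X horner_mx_C.
pose Q := horner_mx X q.
have QN j : Q *m N ^+ j = horner_mx X (q * ('X - a%:P) ^+ j).
  by rewrite rmorphM rmorphXn /= NE.
have NQ j : N ^+ j *m Q = Q *m N ^+ j.
  by rewrite QN mulrC rmorphM rmorphXn /= NE.
have QN0 : Q *m N ^+ k.+1 = 0 by rewrite QN -fE mx_root_minpoly.
(* Otherwise the minimal polynomial would divide q^2 (x - a)^k, and x - a would divide q. *)
have QNQ : Q *m N ^+ k *m Q != 0.
  rewrite QN /Q -[_ *m _]rmorphM /=; apply/eqP => /mxminpoly_min.
  rewrite -/f fE exprSr mulrA dvdp_mul2l ?dvdp_XsubCl ?(negPf qa) //.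
  by apply: contraNneq f_neq0 => e; rewrite fE exprSr mulrA e mul0r.
have [i [j QNQij]] : exists i j, (Q *m N ^+ k *m Q) i j != 0.
  exact/matrix0Pn.
exists a, k; apply: (@similar_jordan_splitting _ _ _ _ _ (row i Q) (col j Q)).
- by rewrite -row_mul QN0 row0.
- by rewrite -/N colE mulmxA NQ QN0 mul0mx.
- rewrite -/N -row_mul colE mulmxA -row_mul -colE; apply/matrix0Pn.
  by exists 0, 0; rewrite mxE mxE.
Qed.

Lemma jordan_form_exists m (X : 'M[F]_m) : exists s, is_jordan_form X s.
Proof.
elim/ltn_ind: m X => -[|m] IHm X.
  exists [::]; apply/is_jordan_formP; split=> //.
  by rewrite [X]flatmx0; apply: similar_refl.
have [a [k [r [Y XY]]]] := exists_jordan_splitting X.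
have lt_rm : (r < m.+1)%N by rewrite (similar_size XY); lia.
have [s /is_jordan_formP[s_gt0 Ys]] := IHm _ lt_rm Y.
exists ((a, k.+1) :: s); apply/is_jordan_formP; split=> //.
exact: similar_trans XY (similar_dsum (similar_refl _) Ys).
Qed.

(** Existence ensures that [xget] does not fall back on its default [[::]]. *)
Lemma jordan_formP m (X : 'M[F]_m) : is_jordan_form X (jordan_form X).
Proof.
by have [s sP] := jordan_form_exists X; apply: (classical_sets.xgetPex [::]); exists s.
Qed.

(** The form picked by [jordan_form] is arbitrary, but these ranks depend on X only and pin down its
    multiplicities. *)
Lemma jordan_multiplicity_rank m (X : 'M[F]_m) a k :
  let r j := \rank ((X - a%:M) ^+ j) in
  (r k + r k.+2 = 2 * r k.+1 + jordan_multiplicity X a k.+1)%N.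
Proof. exact: is_jordan_form_count (jordan_formP X). Qed.

End JordanExistenceClosed.

(** * Skew-symmetric matrices have even rank *)

Section SkewRank.
Variable F : fieldType.
Hypothesis two_neq0 : 2 != 0 :> F.

(** Comparing determinants gives det A = (-1)^m det A. *)
Lemma skew_unit_even m (A : 'M[F]_m) :
  A^T = - A -> A \in unitmx -> ~~ odd m.
Proof.
move=> skA; rewrite unitmxE unitfE => dA; apply/negP => odd_m.
have := det_tr A; rewrite skA -scaleN1r detZ -signr_odd odd_m expr1 mulN1r.
move=> /eqP; rewrite eq_sym -subr_eq0 opprK -mulr2n -mulr_natl mulf_eq0.
by rewrite (negPf two_neq0) (negPf dA).
Qed.

(** Reduction to the invertible case: if R is a basis of the row space and A = A K R, then skewness
    gives A = R^T (K^T A K) R, and the middle factor is skew of size and rank [\rank A]. *)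
Lemma skew_rank_even m (A : 'M[F]_m) : A^T = - A -> ~~ odd (\rank A).
Proof.
move=> skA; have [R [K AKR]] : exists (R : 'M_(\rank A, m)) K, A *m K *m R = A.
  by exists (row_base A), (pinvmx (row_base A)); rewrite mulmxKpV // eq_row_base.
have RKA : R^T *m K^T *m A = A.
  apply: trmx_inj; by rewrite !trmx_mul !trmxK skA !mulNmx mulmxA AKR.
apply: (@skew_unit_even _ (K^T *m A *m K)).
  by rewrite !trmx_mul trmxK skA mulNmx mulmxN mulmxA.
rewrite -row_full_unit -col_leq_rank.
apply: (@leq_trans (\rank (R^T *m (K^T *m A *m K) *m R))).
  by rewrite !mulmxA RKA AKR.
exact: leq_trans (mxrankM_maxl _ _) (mxrankM_maxr _ _).
Qed.

End SkewRank.

(** * Square roots of invertible matrices *)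

Section SquareRoot.
Variable C : numClosedFieldType.

(** Hensel lifting, one linear factor at a time: p is corrected by a multiple c f so that the
    cofactor of f gains the root a. If f(a) = 0, the condition on c is linear with coefficient 2
    p(a), and this is non-zero because p(a)^2 = a. *)
Lemma poly_sqrt_mod (r : seq C) : 0 \notin r ->
  exists p : {poly C}, \prod_(z <- r) ('X - z%:P) %| p ^+ 2 - 'X.
Proof.
elim: r => [|a r IHr]; first by exists 0; rewrite big_nil dvd1p.
rewrite inE negb_or eq_sym => /andP[a0 /IHr[p]]; rewrite big_cons.
set f := \prod_(z <- r) _ => /dvdpP[g pg].
have sqr c : (p + c *: f) ^+ 2 - 'X = (g + (2 * c) *: p + c ^+ 2 *: f) * f.
  rewrite [RHS]mulrDl [(g + _) * f]mulrDl -pg -!mul_polyC polyC_exp polyCM polyC_natr; ring.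
suff [c rc] : exists c, root (g + (2 * c) *: p + c ^+ 2 *: f) a.
  by exists (p + c *: f); rewrite sqr dvdp_mul // dvdp_XsubCl.
have := congr1 (horner^~ a) pg; rewrite !hornerE => pga.
have [fa0|fa_neq0] := eqVneq f.[a] 0.
  have pa_neq0 : p.[a] != 0.
    apply: contraNneq a0 => pa0; rewrite fa0 pa0 mulr0 expr0n /= sub0r in pga.
    by rewrite -oppr_eq0 pga.
  exists (- g.[a] / (2 * p.[a])); rewrite /root !hornerE fa0 mulr0 addr0.
  apply/eqP => /=; field.
  by rewrite pa_neq0.
(* Here [p + c *: f] takes the value [sqrtC a] at [a]. *)
exists ((sqrtC a - p.[a]) / f.[a]); rewrite /root !hornerE /=.
rewrite -(inj_eq (mulIf fa_neq0)) mul0r !mulrDl -pga; apply/eqP.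
move: f.[a] p.[a] fa_neq0 (sqrtCK a) => fa pa fa_neq0.
by set b := sqrtC a => <-; field.
Qed.

(** Allowing two matrices covers both commutation with A and the relation [A^T *m M = M *m A]. *)
Lemma horner_mx_intertwine m n (A : 'M[C]_m.+1) (B : 'M[C]_n.+1) M p :
  A *m M = M *m B -> horner_mx A p *m M = M *m horner_mx B p.
Proof.
move=> AM; elim/poly_ind: p => [|p c IHp]; first by rewrite !rmorph0 mul0mx mulmx0.
rewrite !rmorphD !rmorphM /= !horner_mx_X !horner_mx_C mulmxDl mulmxDr.
by rewrite -mulmxA AM !mulmxA IHp scalar_mxC.
Qed.

Lemma trmx_horner_mx m (A : 'M[C]_m.+1) p : (horner_mx A p)^T = horner_mx A^T p.
Proof.
elim/poly_ind: p => [|p c IHp]; first by rewrite !rmorph0 trmx0.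
rewrite !rmorphD !rmorphM /= !horner_mx_X !horner_mx_C linearD /= tr_scalar_mx.
rewrite trmx_mul IHp; congr (_ + _).
by apply/esym/horner_mx_intertwine.
Qed.

(** Take p with p^2 = x modulo the characteristic polynomial, which does not vanish at 0, and let B
    = p(A); Cayley-Hamilton gives B^2 = A. The last two clauses record what is used of B being a
    polynomial in A. *)
Lemma mx_sqrt m (A : 'M[C]_m) : A \in unitmx ->
  exists B : 'M[C]_m, [/\ B *m B = A,
    forall M, A *m M = M *m A -> B *m M = M *m B &
    forall M, A^T *m M = M *m A -> B^T *m M = M *m B].
Proof.
case: m A => [|m] A uA.
  by exists A; split=> //; rewrite [LHS]flatmx0 [RHS]flatmx0.
have [r Ar] := closed_field_poly_normal (char_poly A).
rewrite (monicP (char_poly_monic A)) scale1r in Ar.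
have /poly_sqrt_mod[p pr] : 0 \notin r.
  rewrite -root_prod_XsubC -Ar -eigenvalue_root_char.
  apply/eigenvalueP => -[v]; rewrite scale0r => vA /negP[].
  by rewrite -(mulmxK uA v) vA mul0mx.
exists (horner_mx A p); split.
- rewrite -Ar in pr; have [q pq] := dvdpP _ _ pr.
  have := congr1 (horner_mx A) pq; rewrite rmorphM /= Cayley_Hamilton mulr0.
  by rewrite rmorphB rmorphXn /= horner_mx_X => /subr0_eq.
- by move=> M /horner_mx_intertwine.
- by move=> M AM; rewrite trmx_horner_mx; apply: horner_mx_intertwine.
Qed.

End SquareRoot.

(* Unlike strong reality for a given form, this depends on the similarity class
   of [X] only. *)
Definition skew_reversible (F : fieldType) (m : nat) (X : 'M[F]_m) : Prop :=
  exists W s : 'M[F]_m,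
    [/\ W \in unitmx, W^T = - W & X^T *m W = - (W *m X)] /\
    [/\ s *m s = 1%:M, s^T *m W = W *m s & s *m X = - (X *m s)].

(** * Skew-reversible matrices: similarity, block sums and doubling *)

Section SkewReversible.
Variable F : fieldType.

Lemma skew_reversible_similar m n (X : 'M[F]_m) (Y : 'M[F]_n) :
  similar X Y -> skew_reversible Y -> skew_reversible X.
Proof.
move=> XY; have mn := similar_size XY; move: Y XY; case: _ / mn => Y.
move=> [P [Q [PQ QP XP]]] [W [s [[uW skW YW] [ss sW sY]]]].
have [uP uQ] := mulmx1_unit PQ.
have QX : Q *m X = Y *m Q.
  by rewrite -[Q *m X]mulmx1 -PQ mulmxA -[Q *m X *m P]mulmxA XP mulmxA QP mul1mx.
have QP' p (M : 'M_(m, p)) : Q *m (P *m M) = M by rewrite mulmxA QP mul1mx.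
(* W is transported as a bilinear form, s as an operator. *)
exists (Q^T *m W *m Q), (P *m s *m Q); split; split.
- by rewrite !unitmx_mul unitmx_tr uQ uW.
- by rewrite !trmx_mul trmxK skW mulNmx mulmxN mulmxA.
- rewrite !mulmxA -trmx_mul QX trmx_mul -mulmxA [W *m Q]lock -!mulmxA -lock.
  rewrite [_ *m (W *m Q)]mulmxA YW mulNmx mulmxN; congr (- _).
  by rewrite QX !mulmxA.
- by rewrite -!mulmxA QP' [s *m (s *m _)]mulmxA ss mul1mx.
- rewrite !trmx_mul -!mulmxA QP'; congr (_ *m _).
  by rewrite [P^T *m _]mulmxA -trmx_mul QP trmx1 mul1mx [LHS]mulmxA sW mulmxA.
- rewrite -mulmxA QX [X *m _]mulmxA [X *m _]mulmxA XP -!mulmxA -mulmxN.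
  by congr (_ *m _); rewrite mulmxA sY mulNmx mulmxA.
Qed.

Lemma skew_reversible_dsum m n (X : 'M[F]_m) (Y : 'M[F]_n) :
  skew_reversible X -> skew_reversible Y -> skew_reversible (dsum X Y).
Proof.
move=> [W [s [[uW skW XW] [ss sW sX]]]] [W' [s' [[uW' skW' XW'] [ss' sW' sX']]]].
exists (dsum W W'), (dsum s s'); split; split.
- by rewrite unitmxE det_ublock unitrM -!unitmxE uW.
- by rewrite /dsum tr_block_mx !trmx0 skW skW' opp_block_mx !oppr0.
- rewrite /dsum tr_block_mx !trmx0 !mulmx_block !mulmx0 !mul0mx !addr0 !add0r.
  by rewrite XW XW' opp_block_mx !oppr0.
- rewrite /dsum !mulmx_block !mulmx0 !mul0mx !addr0 !add0r ss ss'.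
  by rewrite -scalar_mx_block.
- rewrite /dsum tr_block_mx !trmx0 !mulmx_block !mulmx0 !mul0mx !addr0 !add0r.
  by rewrite sW sW'.
- rewrite /dsum !mulmx_block !mulmx0 !mul0mx !addr0 !add0r sX sX'.
  by rewrite opp_block_mx !oppr0.
Qed.

(** Y is skew for the form D = c t, which may lack any symmetry. Pairing two copies of Y by D and
    -D^T yields a skew-symmetric form. The involution is t on the first copy and its D-adjoint t' =
    D^-1 t^T D on the second. *)
Lemma skew_reversible_double m (Y c t : 'M[F]_m) :
  c \in unitmx -> Y^T *m c = c *m Y -> t *m t = 1%:M -> t *m Y = - (Y *m t) ->
  skew_reversible (dsum Y Y).
Proof.
move=> uc Yc tt tY; pose D := c *m t.
have [ut _] := mulmx1_unit tt.
have uD : D \in unitmx by rewrite unitmx_mul uc.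
have YD : Y^T *m D = - (D *m Y).
  by rewrite mulmxA Yc -!mulmxA tY mulmxN opprK.
clearbody D.
have DtY : D^T *m Y = - (Y^T *m D^T).
  by rewrite -trmx_mul -[Y in LHS]trmxK -trmx_mul YD linearN.
have [t' Dt'] : exists t', D *m t' = t^T *m D.
  by exists (invmx D *m t^T *m D); rewrite !mulmxA mulmxV // mul1mx.
have t't' : t' *m t' = 1%:M.
  apply: (can_inj (mulKmx uD)); rewrite mulmxA Dt' -mulmxA Dt' mulmxA -trmx_mul.
  by rewrite tt trmx1 mul1mx mulmx1.
have t'D : t'^T *m D^T = D^T *m t by rewrite -trmx_mul Dt' trmx_mul trmxK.
have t'Y : t' *m Y = - (Y *m t').
  have DY : D *m Y = - (Y^T *m D) by rewrite YD opprK.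
  have tYt : t^T *m Y^T = - (Y^T *m t^T).
    by rewrite -!trmx_mul tY linearN /= opprK.
  apply: (can_inj (mulKmx uD)); rewrite mulmxN [LHS]mulmxA [D *m (Y *m _)]mulmxA.
  by rewrite Dt' DY mulNmx opprK -!mulmxA DY Dt' mulmxN !mulmxA tYt mulNmx opprK.
exists (block_mx 0 D (- D^T) 0), (dsum t t'); split; split.
- apply: (proj1 (mulmx1_unit (B := block_mx 0 (- (invmx D)^T) (invmx D) 0) _)).
  rewrite mulmx_block !mulmx0 !mul0mx !addr0 !add0r mulmxN mulNmx opprK.
  by rewrite -trmx_mul mulVmx // mulmxV // trmx1 -scalar_mx_block.
- by rewrite tr_block_mx !trmx0 opp_block_mx !oppr0 opprK linearN /= trmxK.
- rewrite /dsum tr_block_mx !trmx0 !mulmx_block !mulmx0 !mul0mx !addr0 !add0r.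
  by rewrite opp_block_mx !oppr0 YD mulmxN mulNmx DtY opprK.
- rewrite /dsum !mulmx_block !mulmx0 !mul0mx !addr0 !add0r tt.
  by rewrite t't' -scalar_mx_block.
- rewrite /dsum tr_block_mx !trmx0 !mulmx_block !mulmx0 !mul0mx !addr0 !add0r.
  by rewrite Dt' mulmxN mulNmx t'D.
- rewrite /dsum !mulmx_block !mulmx0 !mul0mx !addr0 !add0r tY.
  by rewrite t'Y opp_block_mx !oppr0.
Qed.

End SkewReversible.

(** * Forms and involutions on sums of Jordan blocks *)

Section JordanReversible.
Variable F : fieldType.

Definition alt_mx k : 'M[F]_k := diag_mx (\row_i (-1) ^+ i).

Definition rev_mx k : 'M[F]_k := rowsub (@rev_ord k) 1%:M.

Lemma alt_mxK k : alt_mx k *m alt_mx k = 1%:M.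
Proof.
rewrite mulmx_diag -diag_const_mx; congr diag_mx.
by apply/rowP => i; rewrite !mxE -expr2 sqrr_sign.
Qed.

Lemma alt_jordan_block (a : F) k :
  alt_mx k *m jordan_block a k = - (jordan_block (- a) k *m alt_mx k).
Proof.
apply/matrixP => i j; rewrite mul_diag_mx mul_mx_diag !mxE.
case: eqP => [->|_]; first by rewrite mulNr opprK mulrC.
case: eqP => [<-|_]; last by rewrite mulr0 mul0r oppr0.
by rewrite mulr1 mul1r exprS mulN1r opprK.
Qed.

Lemma tr_rev_mx k : (rev_mx k)^T = rev_mx k.
Proof. by apply/matrixP => i j; rewrite !mxE -(inj_eq rev_ord_inj) rev_ordK eq_sym. Qed.

Lemma rev_mxK k : rev_mx k *m rev_mx k = 1%:M.
Proof. by rewrite -rowsubE; apply/matrixP => i j; rewrite !mxE rev_ordK. Qed.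

Lemma rev_mx_unit k : rev_mx k \in unitmx.
Proof. by have [] := mulmx1_unit (rev_mxK k). Qed.

(** Equivalently, [rev_mx k *m jordan_block a k] is symmetric: its (i, j) entry depends on i + j
    only. *)
Lemma rev_jordan_block (a : F) k :
  (jordan_block a k)^T *m rev_mx k = rev_mx k *m jordan_block a k.
Proof.
rewrite -[LHS]trmxK trmx_mul trmxK tr_rev_mx -!rowsubE.
apply/matrixP => i j; rewrite !mxE.
have -> : (rev_ord j == i) = (rev_ord i == j).
  by rewrite -(inj_eq rev_ord_inj) rev_ordK eq_sym.
have -> // : ((rev_ord j).+1 == i :> nat) = ((rev_ord i).+1 == j :> nat).
by have := ltn_ord i; have := ltn_ord j; rewrite /=; lia.
Qed.

Lemma skew_reversible_jordan0 k :
  skew_reversible (dsum (jordan_block (0 : F) k) (jordan_block 0 k)).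
Proof.
apply: (skew_reversible_double (rev_mx_unit k) (rev_jordan_block 0 k) (alt_mxK k)).
by rewrite alt_jordan_block oppr0.
Qed.

(** A reversing involution must exchange the eigenvalues a and -a, so Y contains a block for each,
    and t swaps the two with alternating signs. *)
Lemma skew_reversible_jordan_pair (a : F) k
    (Y := dsum (jordan_block a k) (jordan_block (- a) k)) :
  skew_reversible (dsum Y Y).
Proof.
pose t := block_mx 0 (alt_mx k) (alt_mx k) 0.
apply: (@skew_reversible_double _ _ _ (dsum (rev_mx k) (rev_mx k)) t).
- by rewrite unitmxE det_ublock unitrM -!unitmxE !rev_mx_unit.
- rewrite /Y /dsum tr_block_mx !trmx0 !mulmx_block !mulmx0 !mul0mx !addr0 !add0r.
  by rewrite !rev_jordan_block.
- by rewrite mulmx_block !mulmx0 !mul0mx !addr0 !add0r alt_mxK -scalar_mx_block.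
- rewrite /Y /dsum !mulmx_block !mulmx0 !mul0mx !addr0 !add0r.
  by rewrite !alt_jordan_block opp_block_mx !oppr0 opprK.
Qed.

Lemma perm_eq_even_count (T : eqType) (x : T) s :
  x \in s -> ~~ odd (count_mem x s) -> exists s', perm_eq s [:: x, x & s'].
Proof.
move=> xs; have p1 := perm_to_rem xs.
rewrite (permP p1) /= eqxx add1n oddS negbK => odd_x.
have xr : x \in rem x s by rewrite -has_pred1 has_count odd_gt0.
by exists (rem x (rem x s)); rewrite (perm_trans p1) // perm_cons perm_to_rem.
Qed.

(** Each round removes two copies of J(0, k), or two copies each of J(a, k) and J(-a, k). Both the
    parity and the symmetry under negation survive the removal. *)
Lemma skew_reversible_jordan_sum (s : seq (F * nat)) : 2 != 0 :> F ->
  (forall b, ~~ odd (count_mem b s)) ->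
  (forall a k, count_mem (a, k) s = count_mem (- a, k) s) ->
  skew_reversible (jordan_sum s).
Proof.
move=> two_neq0; have [n] := ubnP (size s); elim: n s => // n IHn s.
case: s => [|[a k] s1] ltsn even_s sym_s.
  by exists 0, 0; do !split; rewrite ?[LHS]flatmx0 ?[RHS]flatmx0 // unitmxE det_mx00 unitr1.
set s := _ :: s1 in ltsn even_s sym_s *.
have as_ : (a, k) \in s by rewrite mem_head.
have [s2 p2] := perm_eq_even_count as_ (even_s (a, k)).
have [a0|a_neq0] := eqVneq a 0.
  apply: (skew_reversible_similar (jordan_sum_perm p2)).
  apply: (skew_reversible_similar (similar_dsumA _ _ _)).
  apply: skew_reversible_dsum; first by rewrite a0; apply: skew_reversible_jordan0.
  apply: IHn => [|b|b j].
  - by have := perm_size p2; move: ltsn => /= ltsn e; lia.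
  - by have := even_s b; rewrite (permP p2) /= !oddD addKb.
  - have := sym_s b j; rewrite !(permP p2) /= a0.
    rewrite !xpair_eqE -[0 == b](inj_eq oppr_inj) oppr0.
    by move/addnI/addnI.
have a_neq : (- a, k) != (a, k).
  rewrite xpair_eqE eqxx andbT eq_sym -subr_eq0 opprK -mulr2n -mulr_natl.
  by rewrite mulf_neq0.
have as2 : (- a, k) \in s2.
  suff : (- a, k) \in s by rewrite (perm_mem p2) !inE (negPf a_neq).
  by rewrite -has_pred1 has_count -sym_s -has_count has_pred1.
have even_s2 b : ~~ odd (count_mem b s2).
  by have := even_s b; rewrite (permP p2) /= !oddD addKb.
have [s3 p3] := perm_eq_even_count as2 (even_s2 _).
have p : perm_eq s (([:: (a, k); (- a, k)] ++ [:: (a, k); (- a, k)]) ++ s3).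
  by apply/permP => P; rewrite (permP p2) /= (permP p3) /=; congr addn; apply: addnCA.
apply: (skew_reversible_similar (jordan_sum_perm p)).
apply: (skew_reversible_similar (jordan_sum_cat _ _)).
apply: skew_reversible_dsum; last first.
  apply: IHn => [|b|b j].
  - by have := perm_size p; move: ltsn => /= ltsn e; lia.
  - by have := even_s2 b; rewrite (permP p3) /= !oddD addKb.
  (* Negation exchanges the two kinds of removed blocks, so both counts drop by the same amount. *)
  - have := sym_s b j; rewrite !(permP p) /= !xpair_eqE.
    rewrite (inj_eq oppr_inj) -eqr_oppLR.
    by move: (nat_of_bool _) (nat_of_bool _) => x y; lia.
apply: (skew_reversible_similar (jordan_sum_cat _ _)).
suff pair : similar (jordan_sum [:: (a, k); (- a, k)])
    (dsum (jordan_block a k) (jordan_block (- a) k)).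
  apply: (skew_reversible_similar (similar_dsum pair pair)).
  exact: skew_reversible_jordan_pair.
apply: similar_dsum; first exact: similar_refl.
apply: similar_trans (similar_dsumC _ _) (similar_sym _).
exact: (similar_dsum0 (0 : 'M[F]_0)).
Qed.

End JordanReversible.

(** * Operators that are skew for a given form J *)

Section SkewOperator.
Variables (C : numClosedFieldType) (m : nat) (J X : 'M[C]_m).
Hypotheses (uJ : J \in unitmx) (skJ : J^T = - J) (JX : X^T *m J = - (J *m X)).

(** The J-adjoint of X is -X, and taking adjoints is compatible with shifts and powers. *)
Lemma skew_shiftX a k :
  ((X - a%:M) ^+ k)^T *m J = J *m (- X - a%:M) ^+ k.
Proof.
elim: k => [|k IHk]; first by rewrite !expmx0 trmx1 mul1mx mulmx1.
rewrite expmxSr trmx_mul -mulmxA IHk expmxS !mulmxA; congr (_ *m _).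
by rewrite linearB /= tr_scalar_mx mulmxBl mulmxBr JX mulmxN scalar_mxC.
Qed.

(** Up to sign, the J-adjoint of (X - a)^k is (X + a)^k. This is what makes J(a, k) and J(-a, k)
    equally frequent. *)
Lemma skew_rankN a k :
  \rank ((X - a%:M) ^+ k) = \rank ((X - (- a)%:M) ^+ k).
Proof.
have -> : X - (- a)%:M = - (- X - a%:M) by rewrite opprB opprK raddfN opprK addrC.
have -> : \rank ((- (- X - a%:M)) ^+ k) = \rank ((- X - a%:M) ^+ k).
  rewrite exprNn -signr_odd; case: (odd k); rewrite ?mul1r //.
  by rewrite expr1 mulN1r mxrank_opp.
rewrite -mxrank_tr -(mxrankMfree _ (B := J)) ?row_free_unit //.
by rewrite skew_shiftX eqmxMfull ?row_full_unit.
Qed.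

Lemma skew_rank_even_sqrX k : ~~ odd (\rank (X ^+ k.*2)).
Proof.
have -> : \rank (X ^+ k.*2) = \rank (J *m X ^+ k.*2).
  by rewrite eqmxMfull ?row_full_unit.
apply: skew_rank_even; first by rewrite pnatr_eq0.
have := skew_shiftX 0 k.*2; rewrite raddf0.
have -> : (- X - 0) ^+ k.*2 = X ^+ k.*2 by rewrite subr0 -mul2n !exprM sqrrN.
rewrite subr0 => XJ.
by rewrite trmx_mul skJ mulmxN XJ.
Qed.

(* If [h] reverses [X] then [J *m (X - a%:M) ^+ k *m h] is again alternating. *)
Lemma reversed_rank_even (h : 'M[C]_m) a k :
  h^T *m J *m h = J -> h *m h = 1%:M -> h *m X = - (X *m h) ->
  ~~ odd (\rank ((X - a%:M) ^+ k)).
Proof.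
move=> hJ hh hX; have [uh _] := mulmx1_unit hh.
have {}hJ : h^T *m J = J *m h by rewrite -{2}hJ -mulmxA hh mulmx1.
have hN : h *m (- X - a%:M) ^+ k = (X - a%:M) ^+ k *m h.
  elim: k => [|k IHk]; first by rewrite !expmx0 mulmx1 mul1mx.
  rewrite expmxSr mulmxA IHk expmxSr -!mulmxA; congr (_ *m _).
  by rewrite mulmxBr mulmxN hX opprK mulmxBl scalar_mxC.
have -> : \rank ((X - a%:M) ^+ k) = \rank (J *m ((X - a%:M) ^+ k *m h)).
  by rewrite eqmxMfull ?row_full_unit // mxrankMfree ?row_free_unit.
apply: skew_rank_even; first by rewrite pnatr_eq0.
rewrite trmx_mul skJ mulmxN trmx_mul; congr (- _).
by rewrite -[LHS]mulmxA skew_shiftX [LHS]mulmxA hJ -mulmxA hN.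
Qed.

(* Two forms for which [X] is skew differ by an operator [A] commuting with
   [X]; a square root of [A] carries the one to the other. *)
Lemma skew_reversible_transport : skew_reversible X ->
  exists h, [/\ h^T *m J *m h = J, h *m h = 1%:M & h *m X = - (X *m h)].
Proof.
move=> [W [s [[uW skW XW] [ss sW sX]]]].
have [A WE] : exists A, W = J *m A by exists (invmx J *m W); rewrite mulKVmx.
have uA : A \in unitmx by move: uW; rewrite WE unitmx_mul => /andP[].
have AX : A *m X = X *m A.
  apply: (can_inj (mulKmx uJ)); rewrite !mulmxA -WE.
  by apply: oppr_inj; rewrite -XW WE mulmxA JX mulNmx.
(* Since W and J are both skew, A is self-adjoint for J. B inherits this, whence B^T J B = J B^2 =
   W. *)
have AJ : A^T *m J = J *m A.
  by apply: oppr_inj; rewrite -mulmxN -skJ -trmx_mul -WE skW.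
have [B [BB BA BJ]] := mx_sqrt uA.
have {BA}BX := BA _ AX; have {}BJ := BJ _ AJ.
have uB : B \in unitmx by move: uA; rewrite -BB unitmx_mul => /andP[].
have WB : W = B^T *m J *m B by rewrite BJ -mulmxA BB.
have [B' [BB' B'B]] : exists B', B *m B' = 1%:M /\ B' *m B = 1%:M.
  by exists (invmx B); rewrite mulmxV // mulVmx.
have B'X : B' *m X = X *m B'.
  by rewrite -[X in LHS]mulmx1 -BB' 2!mulmxA -[_ *m X *m B]mulmxA -BX mulmxA B'B mul1mx.
exists (B *m s *m B'); split.
- transitivity (B'^T *m (s^T *m W *m s) *m B').
    by rewrite WB !trmx_mul !mulmxA.
  rewrite sW -[W *m s *m s]mulmxA ss mulmx1 WB !mulmxA -trmx_mul BB' trmx1 mul1mx.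
  by rewrite -mulmxA BB' mulmx1.
- by rewrite -!mulmxA [B' *m (B *m _)]mulmxA B'B mul1mx [s *m (s *m _)]mulmxA ss mul1mx.
- by rewrite -mulmxA B'X mulmxA -[B *m s *m X]mulmxA sX mulmxN mulNmx !mulmxA BX.
Qed.

End SkewOperator.

(** * The standard symplectic form and the equivalence *)

Section Symplectic.
Variables (F : fieldType) (n : nat).

Lemma symplectic_form_skew : (symplectic_form F n)^T = - symplectic_form F n.
Proof.
by rewrite tr_block_mx !trmx0 trmx1 linearN /= trmx1 opp_block_mx !oppr0 opprK.
Qed.

Lemma symplectic_form_unit : symplectic_form F n \in unitmx.
Proof.
have : symplectic_form F n *m (- symplectic_form F n) = 1%:M.
  rewrite mulmxN mulmx_block !mulmx0 !mul0mx !addr0 !add0r !mulmxN !mulNmx !mulmx1.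
  by rewrite opp_block_mx !oppr0 !opprK -scalar_mx_block.
by case/mulmx1_unit.
Qed.

(** The equation h^2 = 1 supplies the inverse of h, so conjugation can be traded for
    anticommutation. *)
Lemma strongly_Ad_realP (X : 'M[F]_(n + n)) (J := symplectic_form F n) :
  strongly_Ad_real X <->
  exists h, [/\ h^T *m J *m h = J, h *m h = 1%:M & h *m X = - (X *m h)].
Proof.
split=> [[h [[uh hJ] hh hX]]|[h [hJ hh hX]]]; exists h.
  by split=> //; rewrite -[LHS](mulmxKV uh) hX mulNmx.
have [uh _] := mulmx1_unit hh.
by split=> //; rewrite hX mulNmx mulmxK.
Qed.

End Symplectic.

Theorem theorem1p4 (R : realType) (n : nat) (hn : (1 <= n)%N)
    (X : 'M[complex R]_(n + n)) (hX : in_sp X) :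
  strongly_Ad_real X <->
  (forall m : nat, (1 <= m)%N -> ~~ odd (jordan_multiplicity X 0 (2 * m)%N)) /\
  (forall lambda : complex R, lambda != 0 -> eigenvalue X lambda ->
     forall k : nat, (1 <= k)%N -> ~~ odd (jordan_multiplicity X lambda k)).
Proof.
have uJ := symplectic_form_unit (complex R) n.
have skJ := symplectic_form_skew (complex R) n.
(* Modulo 2 the middle term of the second difference drops out. *)
have odd_mult a k :
    odd (jordan_multiplicity X a k.+1) =
    odd (\rank ((X - a%:M) ^+ k)) (+) odd (\rank ((X - a%:M) ^+ k.+2)).
  by rewrite -oddD (jordan_multiplicity_rank X a k) oddD mul2n odd_double.
split=> [/strongly_Ad_realP[h [hJ hh hXh]]|[even0 even_neq0]].
  have even_mult a k : ~~ odd (jordan_multiplicity X a k.+1).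
    have even_rank := reversed_rank_even uJ skJ hX a _ hJ hh hXh.
    by rewrite odd_mult (negPf (even_rank k)) (negPf (even_rank k.+2)).
  by split=> [m m1|a _ _ [|k] //]; have -> : (2 * m = (2 * m).-1.+1)%N by lia.
apply/strongly_Ad_realP/skew_reversible_transport => //.
have /is_jordan_formP[s_gt0 Xs] := jordan_formP X.
have count0 a : count_mem (a, 0%N) (jordan_form X) = 0%N.
  by apply/count_memPn; apply/negP => /(allP s_gt0).
apply: (skew_reversible_similar Xs); apply: skew_reversible_jordan_sum.
- by rewrite pnatr_eq0.
- case=> a [|k]; first by rewrite count0.
  rewrite -/(jordan_multiplicity X a k.+1).
  have [->|a_neq0] := eqVneq a 0.
    (* The block size is k + 1: odd k falls under the hypothesis on J(0, 2m), and even k leads to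
       ranks of even powers of X. *)
    have [odd_k|even_k] := boolP (odd k).
      have -> : k.+1 = (2 * k.+1./2)%N by lia.
      by apply: even0; lia.
    have even_rank := skew_rank_even_sqrX uJ skJ hX.
    rewrite odd_mult raddf0 subr0 -[k]even_halfK // -doubleS.
    by rewrite (negPf (even_rank _)) (negPf (even_rank _)).
  have [eig|no_eig] := boolP (eigenvalue X a); first exact: even_neq0.
  (* Away from the spectrum all the ranks are full, so the two parities cancel. *)
  have uXa : X - a%:M \in unitmx.
    by rewrite -row_free_unit -kermx_eq0; apply: negbNE no_eig.
  by rewrite odd_mult !mxrank_unit ?expmx_unit // addbb.
- move=> a [|k]; first by rewrite !count0.
  have := jordan_multiplicity_rank X a k.
  by rewrite /= !(skew_rankN uJ hX a) (jordan_multiplicity_rank X (- a) k) => /addnI.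
Qed.
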